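(* Let $S$ and $T$ be arbitrary non-empty semigroups connected by a Morita context $(S,T,{}_SP_T,{}_TQ_S,\theta,\phi)$. Regard $P\otimes_T Q$ as a semigroup with multiplication $(p\otimes q)(p'\otimes q') = p\otimes q\,\theta(p'\otimes q') = p\otimes\phi(q\otimes p')q'$ and $Q\otimes_S P$ as a semigroup with multiplication $(q\otimes p)(q'\otimes p') = q\otimes\theta(p\otimes q')p' = q\otimes p\,\phi(q'\otimes p')$. Then $\theta: P\otimes_T Q\to S$ and $\phi: Q\otimes_S P\to T$ are almost injective semigroup morphisms. If $\theta$ is surjective, then idempotents lift along $\theta$. Likewise, if $\phi$ is surjective, then idempotents lift along $\phi$.
   Context: Acts: a left $S$-act ${}_SA$ is a set $A$ with a map $S\times A\to A$ satisfying $(st)a=s(ta)$; right acts are defined dually. An $(S,T)$-biact is a left $S$-act and right $T$-act with $(sa)t=s(at)$. Morphisms are maps preserving the actions. For a right $S$-act $A_S$ and a left $S$-act ${}_SB$, the tensor product $A\otimes_S B$ is the quotient of the set $A\times B$ by the smallest equivalence relation identifying $(as,b)$ with $(a,sb)$ for all $a\in A$, $s\in S$, $b\in B$; the class of $(a,b)$ is $a\otimes b$. A Morita context connecting semigroups $S$ and $T$ is a six-tuple $(S,T,{}_SP_T,{}_TQ_S,\theta,\phi)$, where ${}_SP_T$ is an $(S,T)$-biact, ${}_TQ_S$ is a $(T,S)$-biact (neither is required to be unitary), and $\theta:{}_S(P\otimes_T Q)_S\to{}_SS_S$ and $\phi:{}_T(Q\otimes_S P)_T\to{}_TT_T$ are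 biact morphisms such that $\theta(p\otimes q)p'=p\,\phi(q\otimes p')$ and $q'\theta(p\otimes q)=\phi(q'\otimes p)q$ for all $p,p'\in P$, $q,q'\in Q$. A semigroup morphism $\varphi:X\to Y$ is almost injective if it is injective on all subsemigroups of the form $aXb$, where $a,b\in X$ satisfy $a\in Xa$ and $b\in bX$. Idempotents lift along $\varphi$ if for every idempotent $f\in Y$ there exists an idempotent $e\in X$ with $f=\varphi(e)$. *)

(* Defs.v *)
From HB Require Import structures.
From Stdlib Require Import Relation_Operators.
From mathcomp Require Import all_boot.
From mathcomp Require Import all_classical.

Set Implicit Arguments.
Unset Strict Implicit.
Unset Printing Implicit Defensive.

Declare Scope act_scope.
Delimit Scope act_scope with act.
Local Open Scope group_scope.
Local Open Scope classical_set_scope.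
Local Open Scope act_scope.
Local Open Scope quotient_scope.

Reserved Notation "s *> a" (at level 40, left associativity).
Reserved Notation "a <* s" (at level 40, left associativity).

(* semigroupType has no unit and may be empty. The choiceType structure that it
   (and the acts below) carry restricts nothing classically: see gen_choiceMixin
   in boolp. *)

HB.mixin Record isLeftAct (S : semigroupType) A := {
  lact : S -> A -> A;
  lactM : forall (s t : S) (a : A), lact (s * t) a = lact s (lact t a)
}.

#[short(type="leftActType")]
HB.structure Definition LeftAct (S : semigroupType) :=
  {A of isLeftAct S A & Choice A}.

HB.mixin Record isRightAct (T : semigroupType) A := {
  ract : A -> T -> A;
  ractM : forall (a : A) (s t : T), ract a (s * t) = ract (ract a s) t
}.

#[short(type="rightActType")]
HB.structure Definition RightAct (T : semigroupType) :=
  {A of isRightAct T A & Choice A}.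

Notation "s *> a" := (lact s a) : act_scope.
Notation "a <* s" := (ract a s) : act_scope.

HB.mixin Record LeftRightAct_isBiact (S T : semigroupType) A
    of LeftAct S A & RightAct T A := {
  lractA : forall (s : S) (a : A) (t : T), (s *> a) <* t = s *> (a <* t)
}.

#[short(type="biactType")]
HB.structure Definition Biact (S T : semigroupType) :=
  {A of LeftAct S A & RightAct T A & LeftRightAct_isBiact S T A}.

(* S as an (S,S)-biact; an alias, as R^o is for rings, so that the actions are
   not inferred on every semigroup. *)
Definition regular (S : semigroupType) : Type := S.

Section Regular.
Variable S : semigroupType.

HB.instance Definition _ := Choice.copy (regular S) S.

Fact regular_lactM (s t : S) (a : regular S) :
  s * t * (a : S) = s * (t * a) :> S.
Proof. by rewrite mulgA. Qed.

HB.instance Definition _ :=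
  @isLeftAct.Build S (regular S) (fun s a => s * (a : S)) regular_lactM.

Fact regular_ractM (a : regular S) (s t : S) :
  (a : S) * (s * t) = a * s * t :> S.
Proof. by rewrite mulgA. Qed.

HB.instance Definition _ :=
  @isRightAct.Build S (regular S) (fun a s => (a : S) * s) regular_ractM.

Fact regular_lractA (s : S) (a : regular S) (t : S) :
  (s *> a) <* t = s *> (a <* t).
Proof. by rewrite /lact /ract /= mulgA. Qed.

HB.instance Definition _ :=
  @LeftRightAct_isBiact.Build S S (regular S) regular_lractA.

End Regular.

Record biactHom (S T : semigroupType) (A B : biactType S T) := BiactHom {
  biact_fun :> A -> B;
  biact_homl : forall (s : S) (a : A), biact_fun (s *> a) = s *> biact_fun a;
  biact_homr : forall (a : A) (t : T), biact_fun (a <* t) = biact_fun a <* t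
}.

Section Tensor.
Variables (S : semigroupType) (A : rightActType S) (B : leftActType S).

Inductive tensor_step : A * B -> A * B -> Prop :=
  TensorStep (a : A) (s : S) (b : B) : tensor_step (a <* s, b) (a, s *> b).

(* clos_refl_sym_trans is the least equivalence relation containing its
   argument. *)
Definition tensor_rel : rel (A * B) :=
  fun x y => `[< clos_refl_sym_trans _ tensor_step x y >].

Fact tensor_rel_refl : reflexive tensor_rel.
Proof. by move=> x; apply/asboolP; exact: rst_refl. Qed.

Fact tensor_rel_sym : symmetric tensor_rel.
Proof. by move=> x y; apply/asboolP/asboolP => xy; apply: rst_sym. Qed.

Fact tensor_rel_trans : transitive tensor_rel.
Proof.
move=> y x z /asboolP xy /asboolP yz; apply/asboolP.
exact: rst_trans xy yz.
Qed.

Canonical tensor_equiv :=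
  EquivRel tensor_rel tensor_rel_refl tensor_rel_sym tensor_rel_trans.

Definition tensor : Type := {eq_quot tensor_equiv}.

HB.instance Definition _ := Choice.copy tensor {eq_quot tensor_equiv}.

Definition tens (a : A) (b : B) : tensor := \pi_{eq_quot tensor_equiv} (a, b).

Lemma tens_eqP (a a' : A) (b b' : B) :
  tens a b = tens a' b' <->
  clos_refl_sym_trans _ tensor_step (a, b) (a', b').
Proof.
by split=> [/eqmodP/asboolP//|ab]; apply/eqmodP/asboolP.
Qed.

Lemma tensA (a : A) (s : S) (b : B) : tens (a <* s) b = tens a (s *> b).
Proof. by apply/tens_eqP/rst_step. Qed.

Lemma tensorP (x : tensor) : exists a b, x = tens a b.
Proof.
by elim/quotW: x => -[a b]; exists a, b.
Qed.

Definition tensor_repr (x : tensor) : A * B := repr (x : {eq_quot tensor_equiv}).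

Lemma tensor_lift (X : Type) (f : A -> B -> X) :
  (forall a s b, f (a <* s) b = f a (s *> b)) ->
  forall a b, f (tensor_repr (tens a b)).1 (tensor_repr (tens a b)).2 = f a b.
Proof.
move=> fA a b; rewrite /tensor_repr.
have /eqmodP/asboolP := reprK (tens a b : {eq_quot tensor_equiv}).
case: (repr _) => a' b' /=.
suff H x y : clos_refl_sym_trans _ tensor_step x y -> f x.1 x.2 = f y.1 y.2.
  exact: H.
elim=> {x y} [_ _ [c s d]|x|x y _ ->|x y z _ -> _ ->] //=.
Qed.

End Tensor.

Section TensorBiact.
Variables (S T U : semigroupType) (A : biactType S T) (B : biactType T U).
Local Notation AB := (@tensor T A B).

(* The actions of S and U are computed on representatives; tensor_lactE and
   tensor_ractE show that the result does not depend on them. *)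
Definition tensor_lact (s : S) (x : AB) : AB :=
  tens (s *> (tensor_repr x).1) (tensor_repr x).2.

Definition tensor_ract (x : AB) (u : U) : AB :=
  tens (tensor_repr x).1 ((tensor_repr x).2 <* u).

Fact tensor_lactE s (a : A) (b : B) :
  tensor_lact s (tens a b) = tens (s *> a) b.
Proof.
apply: (tensor_lift (f := fun a b => tens (s *> a) b)) => {}a t {}b.
by rewrite -lractA tensA.
Qed.

Fact tensor_ractE (a : A) (b : B) u :
  tensor_ract (tens a b) u = tens a (b <* u).
Proof.
apply: (tensor_lift (f := fun a b => tens a (b <* u))) => {}a t {}b.
by rewrite lractA tensA.
Qed.

Fact tensor_lactM (s t : S) x :
  tensor_lact (s * t) x = tensor_lact s (tensor_lact t x).
Proof. by have [a [b ->]] := tensorP x; rewrite !tensor_lactE lactM. Qed.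

Fact tensor_ractM x (u v : U) :
  tensor_ract x (u * v) = tensor_ract (tensor_ract x u) v.
Proof. by have [a [b ->]] := tensorP x; rewrite !tensor_ractE ractM. Qed.

HB.instance Definition _ := @isLeftAct.Build S AB tensor_lact tensor_lactM.
HB.instance Definition _ := @isRightAct.Build U AB tensor_ract tensor_ractM.

Fact tensor_lractA (s : S) (x : AB) (u : U) : (s *> x) <* u = s *> (x <* u).
Proof.
have [a [b ->]] := tensorP x; rewrite /lact /ract /=.
by rewrite tensor_lactE !tensor_ractE tensor_lactE.
Qed.

HB.instance Definition _ :=
  @LeftRightAct_isBiact.Build S U AB tensor_lractA.

Lemma lact_tens (s : S) (a : A) (b : B) : s *> (tens a b : AB) = tens (s *> a) b.
Proof. exact: tensor_lactE. Qed.

Lemma ract_tens (a : A) (b : B) (u : U) : (tens a b : AB) <* u = tens a (b <* u).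
Proof. exact: tensor_ractE. Qed.

End TensorBiact.

Notation "A '\ox_' T B" := (@tensor T A B)
  (at level 40, T at level 2, left associativity) : type_scope.

Record moritaContext (S T : semigroupType) := MoritaContext {
  moritaP : biactType S T;
  moritaQ : biactType T S;
  theta : biactHom (moritaP \ox_T moritaQ) (regular S);
  phi : biactHom (moritaQ \ox_S moritaP) (regular T);
  theta_phi : forall p q p',
    (theta (tens p q) : S) *> p' = p <* (phi (tens q p') : T);
  phi_theta : forall q' p q,
    q' <* (theta (tens p q) : S) = (phi (tens q' p) : T) *> q
}.

(* A biact morphism f : A -> S makes A a semigroup under x * y := x <* f y.
   For f = theta (and A = P \ox_T Q) and for f = phi (and A = Q \ox_S P) these
   are the products of the tensor products: see mul_thetaE and mul_phiE. *)
Definition homSemigroup (S : semigroupType) (A : biactType S S)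
  (f : biactHom A (regular S)) : Type := A.

Section HomSemigroup.
Variables (S : semigroupType) (A : biactType S S).
Variable f : biactHom A (regular S).

HB.instance Definition _ := Choice.copy (homSemigroup f) A.

Definition hom_mul (x y : homSemigroup f) : homSemigroup f :=
  (x : A) <* (f y : S).

Fact hom_mulA : associative hom_mul.
Proof. by move=> x y z; rewrite /hom_mul biact_homr -ractM. Qed.

HB.instance Definition _ := isSemigroup.Build (homSemigroup f) hom_mulA.

End HomSemigroup.

Section MoritaSemigroups.
Variables (S T : semigroupType) (M : moritaContext S T).

Definition PtensorQ : semigroupType := homSemigroup (theta M).
Definition QtensorP : semigroupType := homSemigroup (phi M).

Definition thetaS : PtensorQ -> S := theta M.
Definition phiS : QtensorP -> T := phi M.

Implicit Types (p : moritaP M) (q : moritaQ M).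

Lemma mul_thetaE p q p' q' :
  (tens p q : PtensorQ) * (tens p' q' : PtensorQ) =
    tens p (q <* (theta M (tens p' q') : S)).
Proof. exact: ract_tens. Qed.

Lemma mul_thetaE' p q p' q' :
  (tens p q : PtensorQ) * (tens p' q' : PtensorQ) =
    tens p ((phi M (tens q p') : T) *> q').
Proof. by rewrite mul_thetaE phi_theta. Qed.

Lemma mul_phiE q p q' p' :
  (tens q p : QtensorP) * (tens q' p' : QtensorP) =
    tens q (p <* (phi M (tens q' p') : T)).
Proof. exact: ract_tens. Qed.

Lemma mul_phiE' q p q' p' :
  (tens q p : QtensorP) * (tens q' p' : QtensorP) =
    tens q ((theta M (tens p q') : S) *> p').
Proof. by rewrite mul_phiE theta_phi. Qed.

End MoritaSemigroups.

Definition semigroup_morphism (X Y : semigroupType) (f : X -> Y) : Prop :=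
  {morph f : x y / x * y}.

Definition almost_injective (X Y : semigroupType) (f : X -> Y) : Prop :=
  semigroup_morphism f /\
  forall a b : X,
    [set x * a | x in [set: X]] a -> [set b * x | x in [set: X]] b ->
    set_inj [set a * x * b | x in [set: X]] f.

Definition idempotents_lift (X Y : semigroupType) (f : X -> Y) : Prop :=
  forall y : Y, y * y = y -> exists2 x : X, x * x = x & y = f x.

(* Main.v *)
(* Both tensor semigroups carry a product [x * y = x <* f y], where [f] is the
   biact morphism [theta] or [phi]. If [a = u * a], then every [z] in [a X b]
   satisfies [z = u * z = u <* f z], so [z] is determined by [f z]. If [f x] is
   an idempotent [y], then [x * x = x <* y] is an idempotent above [y]. *)
Require Import Defs.
From mathcomp Require Import all_boot.
From mathcomp Require Import all_classical.

Local Open Scope classical_set_scope.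

Section HomSemigroupTheory.
Local Open Scope group_scope.
Variables (S : semigroupType) (A : biactType S S).
Variable f : biactHom A (regular S).

Let F : homSemigroup f -> S := f.

Lemma hom_mulE (x y : homSemigroup f) : x * y = ract (x : A) (F y).
Proof. by []. Qed.

(** The right factor enters a product only through its image under [F]. *)
Lemma hom_mul_congr (x y z : homSemigroup f) : F y = F z -> x * y = x * z.
Proof. by move=> Fyz; rewrite !hom_mulE Fyz. Qed.

Lemma homSemigroup_morphism : semigroup_morphism F.
(* The right action on [regular S] is multiplication in [S]. *)
Proof. by move=> x y; rewrite /F hom_mulE biact_homr. Qed.

Lemma homSemigroup_almost_injective : almost_injective F.
Proof.
split; first exact: homSemigroup_morphism.
move=> a b [u _ ua] _ _ _ /set_mem[x _ <-] /set_mem[y _ <-] Fxy.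
have fixu z : a * z * b = u * (a * z * b) by rewrite !mulgA ua.
by rewrite (fixu x) (fixu y); exact: hom_mul_congr.
Qed.

Lemma homSemigroup_idempotents_lift :
  set_surj [set: homSemigroup f] [set: S] F -> idempotents_lift F.
Proof.
move=> Fsurj y yy; have [x _ Fx] := Fsurj y I.
exists (x * x); last by rewrite homSemigroup_morphism Fx.
(* Regrouped as [x * (x * (x * x)) = x * x], both right factors lie over [y]. *)
by rewrite -mulgA; apply: hom_mul_congr; rewrite !homSemigroup_morphism Fx !yy.
Qed.

End HomSemigroupTheory.

Theorem theorem2p8 (S T : semigroupType) (S_neq0 : inhabited S)
    (T_neq0 : inhabited T) (M : moritaContext S T) :
  [/\ almost_injective (@thetaS S T M),
      almost_injective (@phiS S T M),
      set_surj [set: PtensorQ M] [set: S] (@thetaS S T M) ->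
        idempotents_lift (@thetaS S T M)
    & set_surj [set: QtensorP M] [set: T] (@phiS S T M) ->
        idempotents_lift (@phiS S T M)].
Proof.
split.
(* [thetaS] and [phiS] are, by conversion, the map [F] for [f] equal to [theta M] and [phi M]. *)
- exact: homSemigroup_almost_injective.
- exact: homSemigroup_almost_injective.
- exact: homSemigroup_idempotents_lift.
- exact: homSemigroup_idempotents_lift.
Qed.
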